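(* Let $a,b\in\mathbb{R}$, $\tau>0$, $T=N\tau$ with $N\in\mathbb{N}$, $N\ge 1$, let $\varphi\in C^{1}([-\tau,0],\mathbb{R})$ and $f\in C([0,T],\mathbb{R})$. Then the stepwise classical solution $y$ of $$\ddot y(t)=a\,y(t)+b\,y(t-\tau)+f(t),\quad t\in[0,T],\qquad y(t)=\varphi(t),\ \ \dot y(t)=\dot\varphi(t),\quad t\in[-\tau,0],$$ is $$y(t)=\begin{cases}\varphi(t), & -\tau\le t\le 0,\\[1mm] C_{\tau}^{a,b}(t)\,\varphi(0)+S_{\tau}^{a,b}(t)\,\dot\varphi(0)+\displaystyle\int_{-\tau}^{0} S_{\tau}^{a,b}(t-\tau-s)\,b\,\varphi(s)\,ds+\displaystyle\int_{0}^{t} S_{\tau}^{a,b}(t-s)\,f(s)\,ds, & 0\le t\le T.\end{cases}$$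
   Context: Write $(t)_+:=\max\{0,t\}$ and use the convention $0^0=1$. For $a,b\in\mathbb{R}$ and $\tau>0$, the delayed perturbation functions are defined for $t\ge 0$ by the absolutely convergent series $$C_{\tau}^{a,b}(t):=\sum_{k=0}^{\infty}\sum_{m=k}^{\infty}\binom{m}{k}a^{m-k}b^{k}\frac{(t-k\tau)_{+}^{2m}}{(2m)!},\qquad S_{\tau}^{a,b}(t):=\sum_{k=0}^{\infty}\sum_{m=k}^{\infty}\binom{m}{k}a^{m-k}b^{k}\frac{(t-k\tau)_{+}^{2m+1}}{(2m+1)!},$$ and are extended by zero to negative arguments: $C_{\tau}^{a,b}(\eta)=S_{\tau}^{a,b}(\eta)=0$ for $\eta<0$. A function $y:[-\tau,T]\to\mathbb{R}$ is a stepwise (classical) solution of the problem $\ddot y(t)=a\,y(t)+b\,y(t-\tau)+f(t)$ on $[0,T]$ with history $\varphi$ if: (i) $y,\dot y\in C([-\tau,T])$; (ii) for each $k=1,\dots,N$, $\ddot y$ exists and is continuous on $((k-1)\tau,k\tau)$ and admits a continuous extension to $[(k-1)\tau,k\tau]$ (so $\ddot y$ may jump at $t=k\tau$); (iii) the equation holds pointwise for all $t\in((k-1)\tau,k\tau)$, $k=1,\dots,N$; (iv) $y(t)=\varphi(t)$ and $\dot y(t)=\dot\varphi(t)$ for all $t\in[-\tau,0]$ (derivatives of $\varphi$ at the endpoints are one-sided). *)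

(* Defs.v *)
From Stdlib Require Export Reals Factorial.
From Coquelicot Require Export Coquelicot.
Open Scope R_scope.

Definition Icc (lo hi t : R) : Prop := lo <= t <= hi.
Definition Ioo (lo hi t : R) : Prop := lo < t < hi.

(** Coquelicot's [is_derive] with [locally t] restricted to [D]: when [D] is a
    closed interval this is the ordinary derivative at interior points and the
    one-sided derivative at the endpoints. *)
Definition is_derive_on (D : R -> Prop) (f : R -> R) (t l : R) : Prop :=
  filterdiff f (within D (locally t)) (fun h : R => scal h l).

(** [dphi] is the derivative of [phi] on [D]; only values on [D] matter. *)
Definition C1_on (D : R -> Prop) (phi dphi : R -> R) : Prop :=
  (forall t, D t -> is_derive_on D phi t (dphi t)) /\ continuous_on D dphi.

Definition pos_part (t : R) : R := Rmax 0 t.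

(** The inner sums over [m >= k] are indexed by [j = m - k], because
    [Binomial.C m k] does not vanish for [m < k].  Since [x ^ 0 = 1] for every
    [x], the convention 0^0 = 1 is built in.  At [t < 0] the [k = m = 0] term of
    the first series would be 1, so the extension by zero is explicit. *)
Definition delayC (tau a b t : R) : R :=
  if Rlt_dec t 0 then 0 else
  Series (fun k => Series (fun j => let m := (k + j)%nat in
    Binomial.C m k * a ^ (m - k) * b ^ k
      * (pos_part (t - INR k * tau) ^ (2 * m) / INR (fact (2 * m))))).

Definition delayS (tau a b t : R) : R :=
  if Rlt_dec t 0 then 0 else
  Series (fun k => Series (fun j => let m := (k + j)%nat in
    Binomial.C m k * a ^ (m - k) * b ^ k
      * (pos_part (t - INR k * tau) ^ (2 * m + 1) / INR (fact (2 * m + 1))))).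

(** A function on [-tau, N tau] is represented by a total function whose values
    elsewhere are irrelevant.  [dy] and [ddy] are the first and second
    derivatives of [y]; [ddy] is unconstrained at the breakpoints [k tau], and
    [g] is its continuous extension from an open step to the closed one. *)
Definition stepwise_solution (a b tau : R) (N : nat) (f phi dphi y : R -> R)
    : Prop :=
  let J := Icc (- tau) (INR N * tau) in
  exists dy ddy : R -> R,
    (continuous_on J y /\
     (forall t, J t -> is_derive_on J y t (dy t)) /\
     continuous_on J dy) /\
    (forall k : nat, (1 <= k <= N)%nat ->
       let lo := (INR k - 1) * tau in
       let hi := INR k * tau in
       (forall t, Ioo lo hi t -> is_derive dy t (ddy t)) /\
       continuous_on (Ioo lo hi) ddy /\
       (exists g : R -> R, continuous_on (Icc lo hi) g /\
          forall t, Ioo lo hi t -> g t = ddy t) /\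
       (forall t, Ioo lo hi t ->
          ddy t = a * y t + b * y (t - tau) + f t)) /\
    (forall t, Icc (- tau) 0 t -> y t = phi t /\ dy t = dphi t).

(* Main.v *)
Require Import Defs.
From Stdlib Require Import Reals Lra Lia.
From Coquelicot Require Import Coquelicot.
Open Scope R_scope.

(** Write C and S for the delayed perturbation functions.  Everything rests on
    the relations S' = C and C'(t) = a S(t) + b S(t - tau) for t > 0, with
    S(0) = 0 and C(0) = 1.

    To prove them, the k-th inner series are recognised as power series c_k, s_k
    with s_k' = c_k and c_k' = a s_k + b s_(k-1): the latter is Pascal's rule on
    the coefficients ([coefC_binomial], [innerS_derive], [innerC_derive]).  The
    terms with k >= 1 are composed with t |-> (t - k tau)_+ and stay
    differentiable because c_k(0) = s_k(0) = 0 for k >= 1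
    ([derive_pos_part]).  Only the term k = 0, extended by zero, has a corner
    (in S) or a jump (in C) at t = 0, so it is left untruncated: this gives
    [smoothS] and [smoothC], for which the relations hold on the whole line
    ([smoothS_derive], [smoothC_derive]).

    Any solution y satisfies the formula by Green's identity
    ([solution_formula]): for fixed t the derivative of
    G(s) = S(t - s) y'(s) + C(t - s) y(s) is
    S(t - s) (b y(s - tau) + f(s)) - b S(t - tau - s) y(s) inside each step.
    As G is continuous, integrating from 0 to t across the breakpoints
    ([RInt_steps_derive]) gives y(t) - C(t) y(0) - S(t) y'(0) on the left; on
    the right a shift by tau cancels the two terms in b except over the history
    interval ([RInt_history]).

    Existence ([solution_exists]) is obtained by differentiating the formula
    twice ([conv_smoothS_derive], [conv_smoothC_derive]) and pasting the result
    to the history at 0 ([paste_derive_on]). *)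

(** * Exponential generating functions *)

Definition egf (u : nat -> R) (x : R) : R :=
  PSeries (fun n => u n / INR (fact n)) x.

Lemma fact_inv_pos n : 0 < / INR (fact n).
Proof. apply Rinv_0_lt_compat, INR_fact_lt_0. Qed.

(** A geometric bound on [u] makes the terms of [egf u] at [r] bounded by those
    of the exponential series at [M * |r|], for every [r]. *)
Lemma egf_CV_radius (u : nat -> R) (M : R) :
  (forall n, Rabs (u n) <= M ^ n) ->
  CV_radius (fun n => u n / INR (fact n)) = p_infty.
Proof.
  intros Hu.
  assert (HM : 0 <= M).
  { generalize (Rabs_pos (u 1%nat)) (Hu 1%nat). simpl. lra. }
  destruct (CV_radius_bounded (fun n => u n / INR (fact n))) as [Hub _].
  assert (H : forall r, 0 <= r ->
            Rbar_le r (CV_radius (fun n => u n / INR (fact n)))).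
  { intros r Hr. apply Hub. exists (exp (M * r)). intros n.
    assert (Hp : 0 <= M * r) by (apply Rmult_le_pos; lra).
    apply Rle_trans with ((M * r) ^ n / INR (fact n)).
    - unfold Rdiv. rewrite !Rabs_mult, <- RPow_abs, (Rabs_pos_eq r) by lra.
      rewrite (Rabs_pos_eq (/ INR (fact n))) by (apply Rlt_le, fact_inv_pos).
      rewrite Rpow_mult_distr.
      replace (M ^ n * r ^ n * / INR (fact n))
        with (M ^ n * (/ INR (fact n) * r ^ n)) by ring.
      rewrite Rmult_assoc.
      apply Rmult_le_compat_r; [|apply Hu].
      apply Rmult_le_pos; [apply Rlt_le, fact_inv_pos|apply pow_le; lra].
    - eapply Rle_trans; [|apply (exp_ge_taylor _ n Hp)].
      destruct n as [|n]; [apply Rle_refl|].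
      rewrite tech5.
      assert (0 <= sum_f_R0 (fun k => (M * r) ^ k / INR (fact k)) n); [|lra].
      apply cond_pos_sum. intros k.
      apply Rmult_le_pos; [apply pow_le; lra|apply Rlt_le, fact_inv_pos]. }
  destruct (CV_radius _) as [r| |]; trivial.
  - assert (H0 := H (Rabs r + 1)). assert (Hr := Rle_abs r).
    assert (Hr' := Rabs_pos r). simpl in H0. lra.
  - now elim (H 0 (Rle_refl 0)).
Qed.

Lemma egf_derive (u : nat -> R) (M : R) :
  (forall n, Rabs (u n) <= M ^ n) ->
  forall x, is_derive (egf u) x (egf (fun n => u (S n)) x).
Proof.
  intros Hu x. unfold egf at 2.
  rewrite (PSeries_ext _ (PS_derive (fun n => u n / INR (fact n)))).
  - apply is_derive_PSeries. now rewrite (egf_CV_radius u M Hu).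
  - intros n. unfold PS_derive.
    rewrite fact_simpl, mult_INR.
    field. split; [apply INR_fact_neq_0|apply not_0_INR; lia].
Qed.

Lemma egf_ex_pseries (u : nat -> R) (M : R) :
  (forall n, Rabs (u n) <= M ^ n) ->
  forall x, ex_pseries (fun n => u n / INR (fact n)) x.
Proof.
  intros Hu x. apply CV_radius_inside. now rewrite (egf_CV_radius u M Hu).
Qed.

Lemma egf_0 (u : nat -> R) : egf u 0 = u 0%nat.
Proof. unfold egf. rewrite PSeries_0. simpl. field. Qed.

(** * Taylor coefficients of the inner series *)

(** [coefC a b k n] is the [n]-th derivative at 0 of the [k]-th inner series of
    [delayC].  The recursion over two steps is the equation
    c_k'' = a c_k + b c_(k-1) that this series satisfies. *)
Fixpoint coefC (a b : R) (k n : nat) : R :=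
  match n with
  | O => match k with O => 1 | S _ => 0 end
  | S O => 0
  | S (S n') =>
      a * coefC a b k n'
      + match k with O => 0 | S k' => b * coefC a b k' n' end
  end.

Definition coefS (a b : R) (k n : nat) : R :=
  match n with O => 0 | S n' => coefC a b k n' end.

Lemma coefC_bound a b n :
  forall k, Rabs (coefC a b k n) <= (1 + Rabs a + Rabs b) ^ n.
Proof.
  set (M := 1 + Rabs a + Rabs b).
  assert (Ha := Rabs_pos a). assert (Hb := Rabs_pos b).
  assert (HM : 1 <= M) by (unfold M; lra).
  (* The recursion reaches two steps back, so the induction carries two
     consecutive indices. *)
  enough (H : forall k, Rabs (coefC a b k n) <= M ^ n
                        /\ Rabs (coefC a b k (S n)) <= M ^ (S n)).
  { intros k. apply H. }
  induction n as [|n IH]; intros k.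
  - split; simpl.
    + destruct k; rewrite ?Rabs_R1, ?Rabs_R0; lra.
    + rewrite Rabs_R0. lra.
  - split; [apply IH|].
    assert (HP : 0 <= M ^ n) by (apply pow_le; lra).
    assert (HN : (Rabs a + Rabs b) * M ^ n <= M ^ S (S n)).
    { simpl. rewrite <- Rmult_assoc. apply Rmult_le_compat_r; trivial.
      unfold M at 1. nra. }
    assert (H1 : Rabs (a * coefC a b k n) <= Rabs a * M ^ n).
    { rewrite Rabs_mult. apply Rmult_le_compat_l; trivial. apply IH. }
    assert (H2 : Rabs (match k with O => 0 | S k' => b * coefC a b k' n end)
                 <= Rabs b * M ^ n).
    { destruct k.
      - rewrite Rabs_R0. now apply Rmult_le_pos.
      - rewrite Rabs_mult. apply Rmult_le_compat_l; trivial. apply IH. }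
    change (Rabs (a * coefC a b k n
       + match k with O => 0 | S k' => b * coefC a b k' n end) <= M ^ S (S n)).
    eapply Rle_trans; [apply Rabs_triang|]. lra.
Qed.

Lemma coefS_bound a b k n :
  Rabs (coefS a b k n) <= (1 + Rabs a + Rabs b) ^ n.
Proof.
  assert (Ha := Rabs_pos a). assert (Hb := Rabs_pos b).
  destruct n as [|n]; simpl coefS.
  - rewrite Rabs_R0. simpl. lra.
  - eapply Rle_trans; [apply coefC_bound|].
    apply Rle_pow; [lra|lia].
Qed.

Lemma coefC_S a b k n :
  coefC a b k (S n)
  = a * coefS a b k n + match k with O => 0 | S k' => b * coefS a b k' n end.
Proof. destruct n; [destruct k; simpl; ring|reflexivity]. Qed.

Lemma coefC_odd a b m : forall k, coefC a b k (2 * m + 1) = 0.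
Proof.
  induction m as [|m IH]; intros k; [reflexivity|].
  replace (2 * S m + 1)%nat with (S (S (2 * m + 1))) by lia.
  change (a * coefC a b k (2 * m + 1)
       + match k with O => 0 | S k' => b * coefC a b k' (2 * m + 1) end = 0).
  rewrite IH. destruct k; rewrite ?IH; ring.
Qed.

Lemma coefC_SS_even a b k m :
  coefC a b k (2 * S m) = a * coefC a b k (2 * m)
       + match k with O => 0 | S k' => b * coefC a b k' (2 * m) end.
Proof. now replace (2 * S m)%nat with (S (S (2 * m))) by lia. Qed.

Lemma coefC_small a b m : forall k, (m < k)%nat -> coefC a b k (2 * m) = 0.
Proof.
  induction m as [|m IH]; intros k Hk; (destruct k; [lia|]); [reflexivity|].
  rewrite coefC_SS_even, !IH by lia. ring.
Qed.

Lemma C_n_0 n : Binomial.C n 0 = 1.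
Proof.
  unfold Binomial.C. rewrite Nat.sub_0_r. simpl. field. apply INR_fact_neq_0.
Qed.

Lemma C_n_n n : Binomial.C n n = 1.
Proof.
  unfold Binomial.C. rewrite Nat.sub_diag. simpl. field. apply INR_fact_neq_0.
Qed.

(** The recursion of [coefC] along even indices is Pascal's rule. *)
Lemma coefC_binomial a b m : forall k, (k <= m)%nat ->
  coefC a b k (2 * m) = Binomial.C m k * a ^ (m - k) * b ^ k.
Proof.
  induction m as [|m IH]; intros k Hk.
  - replace k with O by lia. rewrite C_n_0. simpl. ring.
  - rewrite coefC_SS_even. destruct k as [|k].
    + rewrite IH by lia. rewrite !C_n_0, !Nat.sub_0_r. simpl. ring.
    + destruct (Nat.eq_dec k m) as [->|Hkm].
      * rewrite coefC_small, IH by lia. rewrite !Nat.sub_diag, !C_n_n.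
        simpl. ring.
      * rewrite !IH, <- pascal by lia.
        replace (S m - S k)%nat with (m - k)%nat by lia.
        replace (m - k)%nat with (S (m - S k)) by lia.
        simpl. ring.
Qed.

(** * Inner series *)

Definition innerC (a b : R) (k : nat) : R -> R := egf (coefC a b k).
Definition innerS (a b : R) (k : nat) : R -> R := egf (coefS a b k).

Lemma innerS_derive a b k x : is_derive (innerS a b k) x (innerC a b k x).
Proof.
  apply (egf_derive (coefS a b k) (1 + Rabs a + Rabs b)).
  intros n. apply coefS_bound.
Qed.

Lemma innerC_derive a b k x :
  is_derive (innerC a b k) x
    (a * innerS a b k x
     + match k with O => 0 | S k' => b * innerS a b k' x end).
Proof.
  set (M := 1 + Rabs a + Rabs b).
  assert (Hex : forall k, ex_pseries (fun n => coefS a b k n / INR (fact n)) x).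
  { intros k'. apply (egf_ex_pseries _ M). intros n. apply coefS_bound. }
  replace (a * _ + _) with (egf (fun n => coefC a b k (S n)) x).
  { apply (egf_derive (coefC a b k) M). intros n. apply coefC_bound. }
  unfold innerS, egf. destruct k as [|k].
  - rewrite Rplus_0_r, <- PSeries_scal. apply PSeries_ext. intros n.
    rewrite coefC_S. unfold PS_scal, scal. simpl. unfold mult. simpl.
    unfold Rdiv. ring.
  - rewrite <- !PSeries_scal, <- PSeries_plus.
    + apply PSeries_ext. intros n.
      rewrite coefC_S. unfold PS_plus, PS_scal, plus, scal. simpl.
      unfold mult. simpl. unfold Rdiv. ring.
    + apply ex_pseries_scal; [apply Rmult_comm|apply Hex].
    + apply ex_pseries_scal; [apply Rmult_comm|apply Hex].
Qed.

Lemma innerS_0 a b k : innerS a b k 0 = 0.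
Proof. apply egf_0. Qed.

Lemma innerC_0 a b : innerC a b 0 0 = 1.
Proof. apply egf_0. Qed.

Lemma innerC_S_0 a b k : innerC a b (S k) 0 = 0.
Proof. apply egf_0. Qed.

Lemma is_series_even (u : nat -> R) (l : R) :
  (forall m, u (2 * m + 1)%nat = 0) ->
  is_series u l -> is_series (fun m => u (2 * m)%nat) l.
Proof.
  intros Hodd Hu.
  apply (is_lim_seq_ext (fun n => sum_n u (2 * n)) _ l).
  - induction n as [|n IH]; [now rewrite !sum_O|].
    replace (2 * S n)%nat with (S (S (2 * n))) by lia.
    rewrite !sum_Sn, <- IH. generalize (Hodd n).
    replace (2 * n + 1)%nat with (S (2 * n)) by lia. intros ->.
    replace (2 * S n)%nat with (S (S (2 * n))) by lia.
    unfold plus. simpl. ring.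
  - apply (is_lim_seq_subseq _ l (fun n => (2 * n)%nat)).
    + apply eventually_subseq. intros n. lia.
    + exact Hu.
Qed.

Lemma is_series_odd (u : nat -> R) (l : R) :
  (forall m, u (2 * m)%nat = 0) ->
  is_series u l -> is_series (fun m => u (2 * m + 1)%nat) l.
Proof.
  intros Heven Hu.
  apply (is_lim_seq_ext (fun n => sum_n u (2 * n + 1)) _ l).
  - induction n as [|n IH].
    + change (2 * 0 + 1)%nat with 1%nat. rewrite sum_Sn, !sum_O.
      generalize (Heven 0%nat). simpl. intros ->. unfold plus. simpl. ring.
    + generalize (Heven (S n)).
      replace (2 * S n + 1)%nat with (S (S (2 * n + 1))) by lia.
      replace (2 * S n)%nat with (S (2 * n + 1)) by lia.
      intros H0. rewrite !sum_Sn, <- IH, H0.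
      replace (2 * S n + 1)%nat with (S (S (2 * n + 1))) by lia.
      unfold plus. simpl. ring.
  - apply (is_lim_seq_subseq _ l (fun n => (2 * n + 1)%nat)).
    + apply eventually_subseq. intros n. lia.
    + exact Hu.
Qed.

Lemma egf_is_series (u : nat -> R) (M : R) :
  (forall n, Rabs (u n) <= M ^ n) ->
  forall x, is_series (fun n => u n * (x ^ n / INR (fact n))) (egf u x).
Proof.
  intros Hu x.
  apply (is_series_ext (fun n => scal (pow_n x n) (u n / INR (fact n)))).
  - intros n. rewrite pow_n_pow. unfold scal. simpl. unfold mult. simpl.
    unfold Rdiv. ring.
  - apply PSeries_correct, (egf_ex_pseries u M Hu).
Qed.

Lemma innerC_series a b k x :
  Series (fun j => let m := (k + j)%nat in
    Binomial.C m k * a ^ (m - k) * b ^ k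
      * (x ^ (2 * m) / INR (fact (2 * m)))) = innerC a b k x.
Proof.
  assert (H := egf_is_series _ _ (fun n => coefC_bound a b n k) x).
  apply is_series_even in H; [|intros m; rewrite coefC_odd; ring].
  unfold innerC. rewrite <- (is_series_unique _ _ H). symmetry.
  rewrite (Series_incr_n_aux _ k).
  - apply Series_ext. intros j. cbv zeta. rewrite coefC_binomial by lia.
    reflexivity.
  - intros m Hm. rewrite coefC_small by assumption. ring.
Qed.

Lemma innerS_series a b k x :
  Series (fun j => let m := (k + j)%nat in
    Binomial.C m k * a ^ (m - k) * b ^ k
      * (x ^ (2 * m + 1) / INR (fact (2 * m + 1)))) = innerS a b k x.
Proof.
  assert (Hodd : forall m, coefS a b k (2 * m + 1) = coefC a b k (2 * m)).
  { intros m. now rewrite Nat.add_1_r. }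
  assert (Heven : forall m, coefS a b k (2 * m) = 0).
  { intros [|m]; [reflexivity|].
    replace (2 * S m)%nat with (S (2 * m + 1)) by lia. apply coefC_odd. }
  assert (H := egf_is_series _ _ (fun n => coefS_bound a b k n) x).
  apply is_series_odd in H; [|intros m; rewrite Heven; ring].
  unfold innerS. rewrite <- (is_series_unique _ _ H). symmetry.
  rewrite (Series_incr_n_aux _ k).
  - apply Series_ext. intros j. cbv zeta.
    rewrite Hodd, coefC_binomial by lia. reflexivity.
  - intros m Hm. rewrite Hodd, coefC_small by assumption. ring.
Qed.

(** * Sums of delayed functions *)

Lemma is_series_finite (u : nat -> R) (n : nat) :
  (forall k, (n < k)%nat -> u k = 0) -> is_series u (sum_n u n).
Proof.
  intros Hu. apply (is_lim_seq_ext_loc (fun _ => sum_n u n) _ (sum_n u n)).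
  - exists n. intros m Hm. induction Hm as [|m Hm IH]; [reflexivity|].
    rewrite sum_Sn, <- IH, Hu by lia. symmetry. apply Rplus_0_r.
  - apply is_lim_seq_const.
Qed.

Lemma pos_part_pos x : 0 <= x -> pos_part x = x.
Proof. apply Rmax_right. Qed.

Lemma pos_part_neg x : x <= 0 -> pos_part x = 0.
Proof. intros. now apply Rmax_left. Qed.

(** Truncation creates no corner at 0 when the derivative vanishes there. *)
Lemma derive_pos_part (u du : R -> R) (t : R) :
  (forall x, is_derive u x (du x)) -> du 0 = 0 ->
  is_derive (fun x => u (pos_part x)) t (du (pos_part t)).
Proof.
  intros Hu H0.
  destruct (Rtotal_order t 0) as [Ht|[->|Ht]].
  - rewrite pos_part_neg, H0 by lra.
    apply is_derive_ext_loc with (fun _ => u 0).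
    + apply (filter_imp (fun x => x < 0)); [|now apply open_lt].
      intros x Hx. now rewrite pos_part_neg by lra.
    + apply @is_derive_const.
  - assert (H := Hu 0). apply is_derive_Reals in H. apply is_derive_Reals.
    rewrite pos_part_pos, H0 in * by lra.
    intros eps Heps. destruct (H eps Heps) as [d Hd]. exists d.
    intros h Hh Hhd. rewrite Rplus_0_l. destruct (Rle_dec 0 h) as [Hp|Hn].
    + rewrite !pos_part_pos by lra. specialize (Hd h Hh Hhd).
      now rewrite Rplus_0_l in Hd.
    + rewrite !pos_part_neg by lra.
      replace ((u 0 - u 0) / h - 0) with 0 by (field; lra).
      now rewrite Rabs_R0.
  - rewrite pos_part_pos by lra.
    apply is_derive_ext_loc with u; [|apply Hu].
    apply (filter_imp (fun x => 0 < x)); [|now apply open_gt].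
    intros x Hx. now rewrite pos_part_pos by lra.
Qed.

(** The term [k = 0] enters without truncation; this keeps the sum
    differentiable at [t = 0], where an extension by zero would have a corner
    or a jump. *)
Definition delay_sum (tau : R) (u : nat -> R -> R) (t : R) : R :=
  u 0%nat t + Series (fun k => u (S k) (pos_part (t - INR (S k) * tau))).

Lemma exists_step tau t : 0 < tau -> exists n, t < INR n * tau.
Proof.
  intros Htau. destruct (INR_unbounded (t / tau)) as [n Hn]. exists n.
  apply (Rmult_lt_compat_r tau) in Hn; trivial.
  unfold Rdiv in Hn. rewrite Rmult_assoc, Rinv_l, Rmult_1_r in Hn; lra.
Qed.

Lemma delay_terms_finite (tau : R) (u : nat -> R -> R) (n : nat) (t : R) :
  0 < tau -> (forall k, u (S k) 0 = 0) -> t <= INR n * tau ->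
  forall k, (n < k)%nat -> u k (pos_part (t - INR k * tau)) = 0.
Proof.
  intros Htau Hu Ht k Hk. rewrite pos_part_neg.
  - destruct k as [|k]; [lia|apply Hu].
  - apply lt_INR in Hk. apply (Rmult_lt_compat_r tau) in Hk; trivial. lra.
Qed.

Lemma delay_sum_finite (tau : R) (u : nat -> R -> R) (n : nat) (t : R) :
  0 < tau -> (forall k, u (S k) 0 = 0) -> t <= INR n * tau ->
  delay_sum tau u t
  = u 0%nat t + sum_n (fun k => u (S k) (pos_part (t - INR (S k) * tau))) n.
Proof.
  intros Htau Hu Ht. unfold delay_sum. f_equal.
  apply is_series_unique, is_series_finite.
  intros k Hk. apply (delay_terms_finite tau u n); trivial. lia.
Qed.

(** Near any point the sum is finite, so it may be differentiated termwise. *)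
Lemma delay_sum_derive (tau : R) (u du : nat -> R -> R) (t : R) :
  0 < tau ->
  (forall k x, is_derive (u k) x (du k x)) ->
  (forall k, u (S k) 0 = 0) -> (forall k, du (S k) 0 = 0) ->
  is_derive (delay_sum tau u) t (delay_sum tau du t).
Proof.
  intros Htau Hu Hu0 Hdu0.
  destruct (exists_step tau t Htau) as [n Hn].
  rewrite (delay_sum_finite tau du n) by (trivial; lra).
  apply is_derive_ext_loc with (fun t => u 0%nat t
    + sum_n (fun k => u (S k) (pos_part (t - INR (S k) * tau))) n).
  - apply (filter_imp (fun x => x < INR n * tau)); [|now apply open_lt].
    intros x Hx. symmetry. apply delay_sum_finite; trivial; lra.
  - apply @is_derive_plus; [apply Hu|].
    apply @is_derive_sum_n. intros k _.
    evar_last.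
    + apply (is_derive_comp (fun x => u (S k) (pos_part x))
               (fun t => t - INR (S k) * tau)).
      * now apply (derive_pos_part (u (S k)) (du (S k))).
      * auto_derive; [trivial|reflexivity].
    + unfold scal. simpl. unfold mult. simpl. ring.
Qed.

(** * Smooth extensions of the delayed perturbation functions *)

(** [smoothC] and [smoothS] agree with [delayC] and [delayS] on [0, oo) but
    continue them to negative arguments differentiably, so that no one-sided
    derivatives are needed at 0. *)
Definition smoothC (tau a b : R) : R -> R := delay_sum tau (innerC a b).
Definition smoothS (tau a b : R) : R -> R := delay_sum tau (innerS a b).

Lemma delayS_series tau a b t : 0 < tau ->
  delayS tau a b t
  = Series (fun k => innerS a b k (pos_part (t - INR k * tau))).
Proof.
  intros Htau. unfold delayS. destruct (Rlt_dec t 0) as [Ht|Ht].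
  - symmetry. apply is_series_unique.
    replace 0 with
      (sum_n (fun k => innerS a b k (pos_part (t - INR k * tau))) 0).
    + apply is_series_finite. apply delay_terms_finite; trivial.
      * intros k. apply innerS_0.
      * simpl. lra.
    + rewrite sum_O, pos_part_neg; [apply innerS_0|simpl; lra].
  - apply Series_ext. intros k. apply innerS_series.
Qed.

Lemma smoothS_0 tau a b : 0 < tau -> smoothS tau a b 0 = 0.
Proof.
  intros Htau. unfold smoothS. rewrite (delay_sum_finite _ _ 0); trivial.
  - rewrite sum_O, innerS_0, pos_part_neg, innerS_0 by (simpl; lra). ring.
  - intros k. apply innerS_0.
  - simpl. lra.
Qed.

Lemma delayS_smoothS tau a b t : 0 < tau ->
  delayS tau a b t = smoothS tau a b (pos_part t).
Proof.
  intros Htau. destruct (exists_step tau t Htau) as [n Hn].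
  destruct (Rlt_dec t 0) as [Ht|Ht].
  - rewrite pos_part_neg by lra. unfold delayS.
    destruct (Rlt_dec t 0) as [_|]; [|lra].
    symmetry. now apply smoothS_0.
  - rewrite pos_part_pos, delayS_series by lra.
    rewrite Series_incr_1.
    + unfold smoothS, delay_sum. f_equal. simpl.
      rewrite pos_part_pos by lra. f_equal. ring.
    + eexists. apply (is_series_finite _ n).
      apply delay_terms_finite; trivial; [|lra]. intros k. apply innerS_0.
Qed.

Lemma delayC_smoothC tau a b t : 0 < tau -> 0 <= t ->
  delayC tau a b t = smoothC tau a b t.
Proof.
  intros Htau Ht. destruct (exists_step tau t Htau) as [n Hn].
  unfold delayC. destruct (Rlt_dec t 0) as [|_]; [lra|].
  rewrite (Series_ext _ (fun k => innerC a b k (pos_part (t - INR k * tau)))).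
  2: { intros k. apply innerC_series. }
  rewrite Series_incr_1.
  - unfold smoothC, delay_sum. f_equal. simpl.
    rewrite pos_part_pos by lra. f_equal. ring.
  - apply ex_series_incr_1.
    eexists. apply (is_series_finite _ n). intros k Hk.
    apply (delay_terms_finite tau (innerC a b) n); trivial; [|lra|lia].
    intros k'. apply innerC_S_0.
Qed.

Lemma smoothS_derive tau a b t : 0 < tau ->
  is_derive (smoothS tau a b) t (smoothC tau a b t).
Proof.
  intros Htau. apply delay_sum_derive; trivial.
  - apply innerS_derive.
  - intros k. apply innerS_0.
  - intros k. apply innerC_S_0.
Qed.

(** The term [b * innerS k] of c_(k+1)' carries the delay (k + 1) tau, that is
    k tau seen from [t - tau]. *)
Lemma smoothC_derive tau a b t : 0 < tau ->
  is_derive (smoothC tau a b) t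
    (a * smoothS tau a b t + b * delayS tau a b (t - tau)).
Proof.
  intros Htau. evar_last.
  - apply delay_sum_derive; trivial.
    + intros k x. apply innerC_derive.
    + intros k. apply innerC_S_0.
    + intros k. simpl. rewrite !innerS_0. ring.
  - destruct (exists_step tau t Htau) as [n Hn].
    rewrite delayS_series by trivial. unfold smoothS, delay_sum.
    rewrite Rplus_0_r, Rmult_plus_distr_l, <- !Series_scal_l, Rplus_assoc.
    f_equal. rewrite <- Series_plus.
    + apply Series_ext. intros k. do 4 f_equal. rewrite S_INR. ring.
    + eexists. apply (is_series_finite _ n). intros k Hk.
      rewrite (delay_terms_finite tau (innerS a b) n);
        trivial; [ring| |lra|lia].
      intros k'. apply innerS_0.
    + eexists. apply (is_series_finite _ n). intros k Hk.
      rewrite (delay_terms_finite tau (innerS a b) n); trivial; [ring| |lra].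
      intros k'. apply innerS_0.
Qed.

Lemma smoothC_0 tau a b : 0 < tau -> smoothC tau a b 0 = 1.
Proof.
  intros Htau. unfold smoothC. rewrite (delay_sum_finite _ _ 0); trivial.
  - rewrite sum_O, innerC_0, pos_part_neg, innerC_S_0 by (simpl; lra). ring.
  - intros k. apply innerC_S_0.
  - simpl. lra.
Qed.

Lemma delayS_neg tau a b t : 0 < tau -> t <= 0 -> delayS tau a b t = 0.
Proof.
  intros Htau Ht. rewrite delayS_smoothS, pos_part_neg by trivial.
  now apply smoothS_0.
Qed.

Lemma delayS_pos tau a b t : 0 < tau -> 0 <= t ->
  delayS tau a b t = smoothS tau a b t.
Proof. intros Htau Ht. now rewrite delayS_smoothS, pos_part_pos. Qed.

Lemma smoothS_continuous tau a b t : 0 < tau -> continuous (smoothS tau a b) t.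
Proof.
  intros Htau. apply @ex_derive_continuous. eexists. now apply smoothS_derive.
Qed.

Lemma smoothC_continuous tau a b t : 0 < tau -> continuous (smoothC tau a b) t.
Proof.
  intros Htau. apply @ex_derive_continuous. eexists. now apply smoothC_derive.
Qed.

Lemma nonexpansive_continuous (f : R -> R) (t : R) :
  (forall x y, Rabs (f x - f y) <= Rabs (x - y)) -> continuous f t.
Proof.
  intros Hf. apply filterlim_locally. intros eps. exists eps. intros x Hx.
  exact (Rle_lt_trans _ _ _ (Hf x t) Hx).
Qed.

Lemma pos_part_continuous t : continuous pos_part t.
Proof.
  apply nonexpansive_continuous. intros x y. unfold pos_part, Rmax.
  destruct (Rle_dec 0 x); destruct (Rle_dec 0 y);
    split_Rabs; lra.
Qed.

Lemma delayS_continuous tau a b t : 0 < tau -> continuous (delayS tau a b) t.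
Proof.
  intros Htau.
  apply (continuous_ext (fun x => smoothS tau a b (pos_part x))).
  - intros x. now rewrite delayS_smoothS.
  - apply continuous_comp; [apply pos_part_continuous|].
    now apply smoothS_continuous.
Qed.

(** * Clamping and derivatives on a set *)

Lemma Rcontinuous_mult (f g : R -> R) (x : R) :
  continuous f x -> continuous g x -> continuous (fun s => f s * g s) x.
Proof. exact (continuous_mult (K := R_AbsRing) f g x). Qed.

Lemma Rcontinuous_plus (f g : R -> R) (x : R) :
  continuous f x -> continuous g x -> continuous (fun s => f s + g s) x.
Proof. exact (continuous_plus (V := R_NormedModule) f g x). Qed.

Lemma Rcontinuous_minus (f g : R -> R) (x : R) :
  continuous f x -> continuous g x -> continuous (fun s => f s - g s) x.
Proof. exact (continuous_minus (V := R_NormedModule) f g x). Qed.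

Lemma Rcontinuous_comp (g f : R -> R) (x : R) :
  continuous g x -> (forall u, continuous f u) ->
  continuous (fun s => f (g s)) x.
Proof. intros Hg Hf. apply (continuous_comp g f); [exact Hg|apply Hf]. Qed.

Ltac prove_continuous_leaf f :=
  lazymatch f with
  | smoothS _ _ _ => apply smoothS_continuous; assumption
  | smoothC _ _ _ => apply smoothC_continuous; assumption
  | delayS _ _ _ => apply delayS_continuous; assumption
  | _ => match goal with H : forall x, continuous f x |- _ => apply H end
  end.

Ltac prove_continuous :=
  lazymatch goal with
  | |- continuous (fun _ => ?c) _ => apply continuous_const
  | |- continuous (fun s => s) _ => apply continuous_id
  | |- continuous (fun s => _ + _) _ =>
      apply Rcontinuous_plus; prove_continuous
  | |- continuous (fun s => _ - _) _ =>
      apply Rcontinuous_minus; prove_continuous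
  | |- continuous (fun s => _ * _) _ =>
      apply Rcontinuous_mult; prove_continuous
  | |- continuous (fun s => ?f s) _ => prove_continuous_leaf f
  | |- continuous (fun s => ?f (@?g s)) _ =>
      apply (Rcontinuous_comp g f);
        [ prove_continuous | intros ?; prove_continuous_leaf f ]
  | |- continuous ?f _ => prove_continuous_leaf f
  end.

Lemma ex_RInt_cont (f : R -> R) (lo hi : R) :
  (forall x, continuous f x) -> ex_RInt f lo hi.
Proof. intros Hf. apply @ex_RInt_continuous. intros z _. apply Hf. Qed.

Definition clamp (lo hi x : R) : R := Rmax lo (Rmin hi x).

Lemma clamp_id lo hi x : lo <= x <= hi -> clamp lo hi x = x.
Proof. intros H. unfold clamp. now rewrite Rmin_right, Rmax_right. Qed.

Lemma clamp_Icc lo hi x : lo <= hi -> Icc lo hi (clamp lo hi x).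
Proof.
  intros H. unfold clamp. split; [apply Rmax_l|].
  apply Rmax_lub; [assumption|apply Rmin_l].
Qed.

Lemma clamp_continuous lo hi x : continuous (clamp lo hi) x.
Proof.
  apply nonexpansive_continuous. intros u v. unfold clamp, Rmax, Rmin.
  repeat destruct Rle_dec; split_Rabs; lra.
Qed.

(** Clamping turns continuity relative to an interval into continuity on the
    line, where the integration and mean value theorems apply. *)
Lemma continuous_clamp (f : R -> R) lo hi x :
  lo <= hi -> continuous_on (Icc lo hi) f ->
  continuous (fun s => f (clamp lo hi s)) x.
Proof.
  intros Hle Hf P HP.
  specialize (Hf _ (clamp_Icc lo hi x Hle) P HP).
  apply (clamp_continuous lo hi x) in Hf.
  revert Hf. unfold filtermap. apply filter_imp.
  intros s Hs. apply Hs. now apply clamp_Icc.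
Qed.

Lemma is_derive_on_spec (D : R -> Prop) (f : R -> R) (t l : R) :
  D t ->
  is_derive_on D f t l <->
  forall eps : posreal, locally t (fun s => D s ->
    Rabs (f s - f t - (s - t) * l) <= eps * Rabs (s - t)).
Proof.
  intros Ht. split.
  - intros [_ H]. apply (H t). intros P HP. now apply filter_le_within.
  - intros H. split; [apply @is_linear_scal_l|].
    intros x Hx.
    (* The only limit of the filter is [t], since [t] belongs to [D]. *)
    assert (x = t) as ->; [|exact H].
    destruct (Req_dec x t) as [|Hxt]; trivial. exfalso.
    assert (Hd : 0 < Rabs (t - x)) by (apply Rabs_pos_lt; lra).
    specialize (Hx (ball x (mkposreal _ Hd)) (locally_ball _ _)).
    apply locally_singleton in Hx. specialize (Hx Ht).
    exact (Rlt_irrefl _ Hx).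
Qed.

Lemma is_derive_on_interior lo hi (f : R -> R) (t l : R) :
  lo < t < hi -> is_derive_on (Icc lo hi) f t l -> is_derive f t l.
Proof.
  intros Ht H. split; [apply @is_linear_scal_l|].
  intros x Hx.
  apply (@is_filter_lim_locally_unique R_AbsRing R_NormedModule) in Hx.
  subst x.
  intros eps.
  assert (HIcc : Icc lo hi t) by (split; lra).
  apply (proj1 (is_derive_on_spec _ _ _ _ HIcc)) with (eps := eps) in H.
  assert (Hn : locally t (fun s => lo < s < hi)).
  { apply (open_and _ _ (open_gt lo) (open_lt hi)). exact Ht. }
  generalize (filter_and _ _ H Hn). apply filter_imp.
  intros s [Hs Hs']. apply Hs. split; lra.
Qed.

Lemma is_derive_derive_on (D : R -> Prop) (f : R -> R) (t l : R) :
  D t -> is_derive f t l -> is_derive_on D f t l.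
Proof.
  intros Ht [_ H]. apply is_derive_on_spec; trivial. intros eps.
  generalize (H t (fun P HP => HP) eps). apply filter_imp. intros s Hs _.
  exact Hs.
Qed.

(** * Integration across the breakpoints *)

(** The derivative [g] is assumed only inside the interval, and comparing [G]
    with the primitive of [g] there needs the mean value theorem alone. *)
Lemma RInt_open_derive (G g : R -> R) (lo hi : R) :
  lo <= hi -> (forall x, continuous G x) -> (forall x, continuous g x) ->
  (forall s, lo < s < hi -> is_derive G s (g s)) ->
  RInt g lo hi = G hi - G lo.
Proof.
  intros Hle HG Hg HD.
  assert (HI : forall s, is_derive (RInt g lo) s (g s)).
  { intros s. apply is_derive_RInt with lo; [|apply Hg].
    apply filter_forall. intros x. apply @RInt_correct.
    now apply ex_RInt_cont. }
  destruct (MVT_gen (fun s => G s - RInt g lo s) lo hi (fun _ => 0))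
    as [c [_ Hc]].
  - rewrite Rmin_left, Rmax_right by assumption. intros s Hs.
    replace 0 with (g s - g s) by ring.
    apply @is_derive_minus; [now apply HD|apply HI].
  - intros s _. apply continuity_pt_filterlim.
    apply Rcontinuous_minus; [apply HG|].
    apply @ex_derive_continuous. eexists. apply HI.
  - rewrite RInt_point in Hc. unfold zero in Hc. simpl in Hc. lra.
Qed.

(** A fundamental theorem of calculus that does not see the breakpoints
    [k * tau], where the second derivative of a solution may jump. *)
Lemma RInt_steps_derive (tau : R) (G g : R -> R) (n : nat) (t : R) :
  0 < tau -> (forall x, continuous G x) -> (forall x, continuous g x) ->
  (forall k : nat, (1 <= k <= n)%nat -> forall s,
     Ioo ((INR k - 1) * tau) (INR k * tau) s -> is_derive G s (g s)) ->
  0 <= t <= INR n * tau ->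
  RInt g 0 t = G t - G 0.
Proof.
  intros Htau HG Hg. revert t. induction n as [|n IH]; intros t HD Ht.
  - replace t with 0 by (simpl in Ht; lra). rewrite RInt_point, Rminus_diag.
    reflexivity.
  - assert (HD' : forall k : nat, (1 <= k <= n)%nat -> forall s,
       Ioo ((INR k - 1) * tau) (INR k * tau) s -> is_derive G s (g s)).
    { intros k Hk. apply HD. lia. }
    destruct (Rle_dec t (INR n * tau)) as [Hn|Hn]; [apply IH; trivial; lra|].
    assert (0 <= INR n * tau) by (apply Rmult_le_pos; [apply pos_INR|lra]).
    rewrite <- (RInt_Chasles g 0 (INR n * tau) t)
      by now apply ex_RInt_cont.
    rewrite IH by (trivial; lra).
    rewrite (RInt_open_derive G g (INR n * tau) t); trivial; [|lra|].
    + unfold plus. simpl. lra.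
    + intros s Hs. apply (HD (S n)); [lia|].
      unfold Ioo. rewrite S_INR in *. split; nra.
Qed.

(** * Representation of a solution *)

Lemma RInt_delayS_zero tau a b (g : R -> R) (c lo hi : R) :
  0 < tau -> c <= lo -> lo <= hi ->
  RInt (fun s => delayS tau a b (c - s) * g s) lo hi = 0.
Proof.
  intros Htau Hc Hle. rewrite (RInt_ext _ (fun _ => 0)).
  - rewrite RInt_const. unfold scal. simpl. unfold mult. simpl. ring.
  - rewrite Rmin_left by trivial. intros s Hs.
    rewrite delayS_neg by lra. apply Rmult_0_l.
Qed.

(** Shifting the integration variable by [tau] makes the two integrals cancel
    except over the history interval. *)
Lemma RInt_history tau a b (g : R -> R) (t : R) :
  0 < tau -> 0 <= t -> (forall x, continuous g x) ->
  RInt (fun s => smoothS tau a b (t - s) * g (s - tau)) 0 t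
  - RInt (fun s => delayS tau a b (t - tau - s) * g s) 0 t
  = RInt (fun s => delayS tau a b (t - tau - s) * g s) (- tau) 0.
Proof.
  intros Htau Ht Hg.
  set (q := fun s => delayS tau a b (t - tau - s) * g s).
  assert (Hq : forall x, continuous q x)
    by (intros x; unfold q; prove_continuous).
  assert (Hex : forall lo hi, ex_RInt q lo hi)
    by (intros; now apply ex_RInt_cont).
  assert (Hshift : RInt (fun s => smoothS tau a b (t - s) * g (s - tau)) 0 t
                   = RInt q (- tau) (t - tau)).
  { transitivity (RInt (fun s => scal 1 (q (1 * s + - tau))) 0 t).
    - apply RInt_ext. rewrite Rmin_left, Rmax_right by trivial. intros s Hs.
      unfold scal, q. simpl. unfold mult. simpl.
      replace (1 * s + - tau) with (s - tau) by ring.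
      rewrite Rmult_1_l. f_equal. rewrite delayS_pos by lra. f_equal. ring.
    - etransitivity; [apply (RInt_comp_lin q 1 (- tau) 0 t), Hex|].
      f_equal; ring. }
  assert (Hz : RInt q (t - tau) t = 0) by (apply RInt_delayS_zero; lra).
  rewrite Hshift.
  generalize (RInt_Chasles q (- tau) (t - tau) t (Hex _ _) (Hex _ _))
             (RInt_Chasles q (- tau) 0 t (Hex _ _) (Hex _ _)).
  rewrite Hz. unfold plus. simpl. lra.
Qed.

(** Green's identity.  With [t] fixed, G(s) = S(t - s) y'(s) + C(t - s) y(s)
    has a derivative in which the terms in [a] cancel, and G(t) = y(t) because
    S(0) = 0 and C(0) = 1. *)
Lemma solution_formula (a b tau : R) (N : nat) (f phi dphi y : R -> R) (t : R) :
  0 < tau -> continuous_on (Icc 0 (INR N * tau)) f ->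
  stepwise_solution a b tau N f phi dphi y ->
  0 <= t <= INR N * tau ->
  y t = delayC tau a b t * phi 0 + delayS tau a b t * dphi 0
        + RInt (fun s => delayS tau a b (t - tau - s) * b * phi s) (- tau) 0
        + RInt (fun s => delayS tau a b (t - s) * f s) 0 t.
Proof.
  intros Htau Hf Hsol Ht.
  destruct Hsol as (dy & ddy & (Hy & Hdy & Hdyc) & Heq & Hini).
  assert (HT : 0 <= INR N * tau) by lra.
  set (cl := clamp (- tau) (INR N * tau)).
  set (Y := fun s => y (cl s)). set (DY := fun s => dy (cl s)).
  set (F := fun s => f (clamp 0 (INR N * tau) s)).
  assert (HY : forall x, continuous Y x)
    by (intros x; apply continuous_clamp; trivial; lra).
  assert (HDY : forall x, continuous DY x)
    by (intros x; apply continuous_clamp; trivial; lra).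
  assert (HF : forall x, continuous F x)
    by (intros x; apply continuous_clamp; trivial; lra).
  set (G := fun s => smoothS tau a b (t - s) * DY s
                     + smoothC tau a b (t - s) * Y s).
  set (g := fun s =>
    smoothS tau a b (t - s) * (b * Y (s - tau) + F s)
    - b * (delayS tau a b (t - tau - s) * Y s)).
  assert (HG : forall x, continuous G x)
    by (intros x; unfold G; prove_continuous).
  assert (Hg : forall x, continuous g x)
    by (intros x; unfold g; prove_continuous).
  assert (HD : RInt g 0 t = G t - G 0).
  { apply (RInt_steps_derive tau G g N t Htau HG Hg); trivial.
    intros k Hk s Hs.
    destruct (Heq k Hk) as (H1 & _ & _ & H2).
    specialize (H1 s Hs). specialize (H2 s Hs). unfold Ioo in Hs.
    assert (Hk1 : 1 <= INR k) by (apply (le_INR 1); lia).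
    assert (HkN : INR k <= INR N) by (apply le_INR; lia).
    assert (Hs' : 0 < s < INR N * tau) by (split; nra).
    assert (Hnear : locally s (fun x => - tau <= x <= INR N * tau)).
    { apply (filter_imp (fun x => - tau < x < INR N * tau)); [intros; lra|].
      apply (open_and _ _ (open_gt (- tau)) (open_lt (INR N * tau))).
      simpl. lra. }
    assert (HYs : is_derive Y s (dy s)).
    { apply is_derive_ext_loc with y.
      - revert Hnear. apply filter_imp. intros x Hx.
        unfold Y, cl. now rewrite clamp_id.
      - apply (is_derive_on_interior (- tau) (INR N * tau)); [lra|].
        apply Hdy. split; lra. }
    assert (HDYs : is_derive DY s (ddy s)).
    { apply is_derive_ext_loc with dy; trivial.
      revert Hnear. apply filter_imp. intros x Hx.
      unfold DY, cl. now rewrite clamp_id. }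
    assert (Hrefl : is_derive (fun x => t - x) s (-1))
      by (auto_derive; [trivial|ring]).
    assert (HS := is_derive_comp _ _ _ _ _
      (smoothS_derive tau a b (t - s) Htau) Hrefl).
    assert (HC := is_derive_comp _ _ _ _ _
      (smoothC_derive tau a b (t - s) Htau) Hrefl).
    assert (HGs := is_derive_plus _ _ _ _ _
      (is_derive_mult _ _ _ _ _ HS HDYs Rmult_comm)
      (is_derive_mult _ _ _ _ _ HC HYs Rmult_comm)).
    evar_last; [exact HGs|].
    rewrite H2. unfold g, DY, Y, F, cl. rewrite !clamp_id by lra.
    unfold plus, scal. simpl. unfold mult. simpl.
    replace (t - s - tau) with (t - tau - s) by ring. ring. }
  assert (HY0 : Y 0 = phi 0).
  { unfold Y, cl. rewrite clamp_id by lra. apply Hini. split; lra. }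
  assert (HDY0 : DY 0 = dphi 0).
  { unfold DY, cl. rewrite clamp_id by lra. apply Hini. split; lra. }
  assert (HYt : Y t = y t).
  { unfold Y, cl. now rewrite clamp_id by lra. }
  assert (Hsplit : RInt g 0 t
    = b * RInt (fun s => delayS tau a b (t - tau - s) * Y s) (- tau) 0
      + RInt (fun s => smoothS tau a b (t - s) * F s) 0 t).
  { rewrite <- RInt_history by (trivial; lra).
    set (u1 := fun s => smoothS tau a b (t - s) * Y (s - tau)).
    set (u2 := fun s => delayS tau a b (t - tau - s) * Y s).
    set (u3 := fun s => smoothS tau a b (t - s) * F s).
    assert (E1 : ex_RInt u1 0 t)
      by (apply ex_RInt_cont; intros x; unfold u1; prove_continuous).
    assert (E2 : ex_RInt u2 0 t)
      by (apply ex_RInt_cont; intros x; unfold u2; prove_continuous).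
    assert (E3 : ex_RInt u3 0 t)
      by (apply ex_RInt_cont; intros x; unfold u3; prove_continuous).
    apply is_RInt_unique.
    apply (is_RInt_ext (fun s => plus (scal b (minus (u1 s) (u2 s))) (u3 s))).
    - intros s _. unfold g, u1, u2, u3, plus, minus, opp, scal. simpl.
      unfold mult, plus. simpl. ring.
    - apply @is_RInt_plus; [|now apply @RInt_correct].
      apply @is_RInt_scal.
      apply @is_RInt_minus; now apply @RInt_correct. }
  rewrite Hsplit in HD. unfold G in HD.
  rewrite Rminus_diag, Rminus_0_r, smoothS_0, smoothC_0, HY0, HDY0, HYt in HD
    by trivial.
  rewrite delayC_smoothC, delayS_pos by lra.
  assert (I1 : RInt (fun s => delayS tau a b (t - tau - s) * b * phi s)
                 (- tau) 0
     = b * RInt (fun s => delayS tau a b (t - tau - s) * Y s) (- tau) 0).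
  { transitivity
      (scal b (RInt (fun s => delayS tau a b (t - tau - s) * Y s) (- tau) 0));
      [|reflexivity].
    rewrite <- RInt_scal.
    - apply RInt_ext. rewrite Rmin_left, Rmax_right by lra. intros s Hs.
      unfold Y, cl. rewrite clamp_id by lra.
      destruct (Hini s) as [-> _]; [split; lra|].
      unfold scal. simpl. unfold mult. simpl. ring.
    - apply ex_RInt_cont. intros x. prove_continuous. }
  assert (I2 : RInt (fun s => delayS tau a b (t - s) * f s) 0 t
     = RInt (fun s => smoothS tau a b (t - s) * F s) 0 t).
  { apply RInt_ext. rewrite Rmin_left, Rmax_right by lra. intros s Hs.
    unfold F. rewrite clamp_id, delayS_pos by lra. reflexivity. }
  rewrite I1, I2. lra.
Qed.

(** * Convolutions *)

Lemma Rderive_scal_r (f : R -> R) (x l c : R) :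
  is_derive f x l -> is_derive (fun s => f s * c) x (l * c).
Proof. intros H. exact (is_derive_scal_l f x l c H). Qed.

Lemma Rderive_shift (f : R -> R) (x l c : R) :
  is_derive f (x - c) l -> is_derive (fun s => f (s - c)) x l.
Proof.
  intros H.
  assert (Hs : is_derive (fun s => s - c) x 1) by (auto_derive; [trivial|ring]).
  evar_last; [exact (is_derive_comp f (fun s => s - c) x l 1 H Hs)|].
  unfold scal. simpl. unfold mult. simpl. ring.
Qed.

Definition conv (K h : R -> R) (t : R) : R :=
  RInt (fun s => K (t - s) * h s) 0 t.

Lemma conv_0 K h : conv K h 0 = 0.
Proof. apply @RInt_point. Qed.

(** Leibniz's rule for an integral whose integrand and upper bound both depend
    on [t]. *)
Lemma conv_derive (K dK h : R -> R) (t : R) :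
  (forall x, is_derive K x (dK x)) -> (forall x, continuous dK x) ->
  (forall x, continuous h x) ->
  is_derive (conv K h) t (K 0 * h t + conv dK h t).
Proof.
  intros HK HdK Hh.
  assert (HcK : forall x, continuous K x)
    by (intros x; apply @ex_derive_continuous; eexists; apply HK).
  assert (HD : forall u v,
    is_derive (fun z => K (z - v) * h v) u (dK (u - v) * h v)).
  { intros u v. apply (Rderive_shift (fun x => K x * h v)).
    apply Rderive_scal_r, HK. }
  assert (H2d : forall u v,
    continuity_2d_pt (fun u v => Derive (fun z => K (z - v) * h v) u) u v).
  { intros u v.
    apply continuity_2d_pt_ext with (fun u v => dK (u - v) * h v).
    - intros x y. symmetry. apply is_derive_unique, HD.
    - apply continuity_2d_pt_mult.
      + apply (continuity_1d_2d_pt_comp dK).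
        * apply continuity_pt_filterlim, HdK.
        * apply continuity_2d_pt_minus;
            [apply continuity_2d_pt_id1|apply continuity_2d_pt_id2].
      + apply (continuity_1d_2d_pt_comp h (fun _ v => v)).
        * apply continuity_pt_filterlim, Hh.
        * apply continuity_2d_pt_id2. }
  assert (Hex : forall x lo hi, ex_RInt (fun s => K (x - s) * h s) lo hi)
    by (intros; apply ex_RInt_cont; intros; prove_continuous).
  evar_last.
  - apply (is_derive_RInt_param_bound_comp_aux3
             (fun x s => K (x - s) * h s) 0 (fun x => x) t 1).
    + apply filter_forall. intros x. apply Hex.
    + exists (mkposreal 1 Rlt_0_1). apply filter_forall. intros x. apply Hex.
    + apply @is_derive_id.
    + exists (mkposreal 1 Rlt_0_1). apply filter_forall. intros x s _.
      eexists. apply HD.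
    + intros s _. apply H2d.
    + exists (mkposreal 1 Rlt_0_1). intros. apply H2d.
    + apply continuity_pt_filterlim.
      change (continuous (fun s => K (t - s) * h s) t). prove_continuous.
  - rewrite Rminus_diag. unfold conv.
    rewrite (RInt_ext _ (fun s => dK (t - s) * h s)).
    + rewrite Rmult_1_r. apply Rplus_comm.
    + intros s _. apply is_derive_unique, HD.
Qed.

Lemma conv_smoothS_derive tau a b (h : R -> R) (t : R) :
  0 < tau -> (forall x, continuous h x) ->
  is_derive (conv (smoothS tau a b) h) t (conv (smoothC tau a b) h t).
Proof.
  intros Htau Hh. evar_last.
  - apply (conv_derive _ (smoothC tau a b)); trivial.
    + intros x. now apply smoothS_derive.
    + intros x. now apply smoothC_continuous.
  - rewrite smoothS_0 by trivial. simpl. ring.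
Qed.

(** Since [delayS] vanishes at negative arguments, it cuts the integral off at
    [x]; this is how the delayed convolution appears in the second derivative
    of the convolution with [smoothS]. *)
Lemma RInt_delayS_conv tau a b (h : R -> R) (x t : R) :
  0 < tau -> (forall x, continuous h x) -> 0 <= t -> x <= t ->
  RInt (fun s => delayS tau a b (x - s) * h s) 0 t
  = conv (smoothS tau a b) h (pos_part x).
Proof.
  intros Htau Hh Ht Hx. destruct (Rle_dec x 0) as [Hn|Hp].
  - rewrite pos_part_neg, conv_0 by trivial. now apply RInt_delayS_zero.
  - rewrite pos_part_pos by lra.
    assert (Hex : forall lo hi,
      ex_RInt (fun s => delayS tau a b (x - s) * h s) lo hi)
      by (intros; apply ex_RInt_cont; intros; prove_continuous).
    rewrite <- (RInt_Chasles _ 0 x t (Hex _ _) (Hex _ _)).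
    rewrite (RInt_delayS_zero _ _ _ _ _ x t) by lra.
    unfold plus. simpl. rewrite Rplus_0_r. apply RInt_ext.
    rewrite Rmin_left, Rmax_right by lra. intros s Hs.
    now rewrite delayS_pos by lra.
Qed.

Lemma conv_smoothC_derive tau a b (h : R -> R) (t : R) :
  0 < tau -> (forall x, continuous h x) -> 0 <= t ->
  is_derive (conv (smoothC tau a b) h) t
    (h t + (a * conv (smoothS tau a b) h t
            + b * conv (smoothS tau a b) h (pos_part (t - tau)))).
Proof.
  intros Htau Hh Ht. evar_last.
  - apply (conv_derive _
      (fun x => a * smoothS tau a b x + b * delayS tau a b (x - tau))); trivial.
    + intros x. now apply smoothC_derive.
    + intros x. prove_continuous.
  - rewrite smoothC_0, Rmult_1_l by trivial. f_equal.
    rewrite <- (RInt_delayS_conv _ _ _ _ _ t) by (trivial; lra).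
    unfold conv.
    set (u1 := fun s => smoothS tau a b (t - s) * h s).
    set (u2 := fun s => delayS tau a b (t - tau - s) * h s).
    assert (E1 : ex_RInt u1 0 t)
      by (apply ex_RInt_cont; intros x; unfold u1; prove_continuous).
    assert (E2 : ex_RInt u2 0 t)
      by (apply ex_RInt_cont; intros x; unfold u2; prove_continuous).
    apply is_RInt_unique.
    apply (is_RInt_ext (fun s => plus (scal a (u1 s)) (scal b (u2 s)))).
    + intros s _. unfold u1, u2, plus, scal. simpl. unfold mult. simpl.
      replace (t - s - tau) with (t - tau - s) by ring. ring.
    + apply @is_RInt_plus; apply @is_RInt_scal; now apply @RInt_correct.
Qed.

Lemma is_derive_on_continuous_on (D : R -> Prop) (f df : R -> R) :
  (forall t, D t -> is_derive_on D f t (df t)) -> continuous_on D f.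
Proof.
  intros H t Ht.
  apply (filterdiff_continuous_aux (K := R_AbsRing) (U := R_NormedModule)
           (V := R_NormedModule) (F := within D (locally t))).
  - eexists. exact (H t Ht).
  - intros P HP. now apply filter_le_within.
Qed.

(** * Pasting at 0 *)

Definition paste (u v : R -> R) (s : R) : R :=
  if Rlt_dec s 0 then u s else v s.

Lemma paste_neg u v s : s < 0 -> paste u v s = u s.
Proof. intros Hs. unfold paste. now destruct (Rlt_dec s 0). Qed.

Lemma paste_pos u v s : 0 <= s -> paste u v s = v s.
Proof. intros Hs. unfold paste. destruct (Rlt_dec s 0); [lra|reflexivity]. Qed.

(** With [pos_part], the pasted function is a sum of compositions of continuous
    functions: x - pos_part x is the truncation to x <= 0. *)
Lemma paste_continuous u v s :
  (forall x, continuous u x) -> (forall x, continuous v x) -> u 0 = v 0 ->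
  continuous (paste u v) s.
Proof.
  intros Hu Hv H0.
  assert (Hpos := pos_part_continuous).
  apply (continuous_ext
    (fun x => u (x - pos_part x) + (v (pos_part x) - v 0))).
  - intros x. destruct (Rlt_dec x 0) as [Hx|Hx].
    + rewrite paste_neg, pos_part_neg, Rminus_0_r, Rminus_diag by lra.
      apply Rplus_0_r.
    + rewrite paste_pos, pos_part_pos, Rminus_diag, H0 by lra.
      apply Rplus_minus.
  - prove_continuous.
Qed.

Lemma paste_derive_on (u v du dv : R -> R) (lo hi t : R) :
  lo <= 0 ->
  (forall s, Icc lo 0 s -> is_derive_on (Icc lo 0) u s (du s)) ->
  (forall s, is_derive v s (dv s)) ->
  u 0 = v 0 -> du 0 = dv 0 ->
  Icc lo hi t ->
  is_derive_on (Icc lo hi) (paste u v) t (paste du dv t).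
Proof.
  intros Hlo Hu Hv H0 Hd0 Ht. apply is_derive_on_spec; trivial. intros eps.
  destruct (Rtotal_order t 0) as [Hneg|[H|Hpos]].
  - assert (Ht' : Icc lo 0 t) by (destruct Ht; split; lra).
    assert (Hut := proj1 (is_derive_on_spec _ _ _ _ Ht') (Hu t Ht') eps).
    generalize (filter_and _ _ Hut (open_lt 0 t Hneg)).
    apply filter_imp. intros s [Hs Hs0] [Hs1 _].
    rewrite !paste_neg by trivial. apply Hs. split; lra.
  - subst t. assert (Ht' : Icc lo 0 0) by (split; lra).
    assert (Hu0 := proj1 (is_derive_on_spec _ _ _ _ Ht') (Hu 0 Ht') eps).
    assert (Hv0 := proj1 (is_derive_on_spec (fun _ => True) _ _ _ I)
                     (is_derive_derive_on _ v 0 _ I (Hv 0)) eps).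
    generalize (filter_and _ _ Hu0 Hv0).
    apply filter_imp. intros s [Hs Hs'] [Hs1 _].
    rewrite !(paste_pos _ _ 0) by lra.
    destruct (Rlt_dec s 0) as [Hs0|Hs0].
    + rewrite paste_neg, <- H0, <- Hd0 by trivial. apply Hs. split; lra.
    + rewrite paste_pos by lra. now apply Hs'.
  - assert (Hvt := is_derive_derive_on (fun _ => True) v t _ I (Hv t)).
    apply (is_derive_on_spec (fun _ => True) _ _ _ I) with (eps := eps) in Hvt.
    generalize (filter_and _ _ Hvt (open_gt 0 t Hpos)).
    apply filter_imp. intros s [Hs Hs0] _.
    rewrite !paste_pos by lra. now apply Hs.
Qed.

(** * Existence of a solution *)

Ltac Rring := lazymatch goal with |- ?x = ?y => change (@eq R x y); ring end.

(** The solution on [0, oo) with y(0) = [p], y'(0) = [v], where [g] is the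
    forcing seen on the first step, history included.  The history term stays
    in [g] beyond [tau] as the constant [b * p]; subtracting the convolution
    with that constant, delayed by [tau], removes it again.  All convolutions
    are thus taken with functions continuous on the line, although the true
    history term drops to zero at [tau]. *)
Definition forward_solution (a b tau p v : R) (g : R -> R) (t : R) : R :=
  smoothC tau a b t * p + smoothS tau a b t * v
  + (conv (smoothS tau a b) g t
     - conv (smoothS tau a b) (fun _ => b * p) (pos_part (t - tau))).

Definition forward_derivative (a b tau p v : R) (g : R -> R) (t : R) : R :=
  (a * smoothS tau a b t + b * delayS tau a b (t - tau)) * p
  + smoothC tau a b t * v
  + (conv (smoothC tau a b) g t
     - conv (smoothC tau a b) (fun _ => b * p) (pos_part (t - tau))).

Lemma forward_solution_derive (a b tau p v : R) (g : R -> R) (t : R) :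
  0 < tau -> (forall x, continuous g x) ->
  is_derive (forward_solution a b tau p v g) t
    (forward_derivative a b tau p v g t).
Proof.
  intros Htau Hg.
  apply @is_derive_plus; [apply @is_derive_plus|apply @is_derive_minus].
  - now apply Rderive_scal_r, smoothC_derive.
  - now apply Rderive_scal_r, smoothS_derive.
  - now apply conv_smoothS_derive.
  - apply (Rderive_shift
      (fun x => conv (smoothS tau a b) (fun _ => b * p) (pos_part x))).
    apply (derive_pos_part _ (conv (smoothC tau a b) (fun _ => b * p))).
    + intros x. apply conv_smoothS_derive; trivial.
      intros. apply continuous_const.
    + apply conv_0.
Qed.

Lemma forward_derivative_continuous (a b tau p v : R) (g : R -> R) (t : R) :
  0 < tau -> (forall x, continuous g x) ->
  continuous (forward_derivative a b tau p v g) t.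
Proof.
  intros Htau Hg.
  assert (Hpos := pos_part_continuous).
  assert (Hconv : forall h : R -> R, (forall x, continuous h x) ->
    forall x, continuous (conv (smoothC tau a b) h) x).
  { intros h Hh x. apply @ex_derive_continuous. eexists.
    apply (conv_derive _
      (fun x => a * smoothS tau a b x + b * delayS tau a b (x - tau))); trivial.
    - intros. now apply smoothC_derive.
    - intros. prove_continuous. }
  assert (H1 := Hconv g Hg).
  assert (H2 := Hconv (fun _ : R => b * p) (fun x => continuous_const _ _)).
  unfold forward_derivative. prove_continuous.
Qed.

Lemma forward_solution_0 a b tau p v g : 0 < tau ->
  forward_solution a b tau p v g 0 = p.
Proof.
  intros Htau. unfold forward_solution.
  rewrite pos_part_neg, smoothC_0, smoothS_0, !conv_0 by lra. ring.
Qed.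

Lemma forward_derivative_0 a b tau p v g : 0 < tau ->
  forward_derivative a b tau p v g 0 = v.
Proof.
  intros Htau. unfold forward_derivative.
  rewrite pos_part_neg, smoothC_0, smoothS_0, delayS_neg, !conv_0 by lra. ring.
Qed.

Lemma forward_derivative_derive_first (a b tau p v : R) (g : R -> R) (t : R) :
  (forall x, continuous g x) -> 0 < t < tau ->
  is_derive (forward_derivative a b tau p v g) t
    (a * forward_solution a b tau p v g t + g t).
Proof.
  intros Hg Ht. assert (Htau : 0 < tau) by lra.
  apply is_derive_ext_loc with (fun t =>
    smoothS tau a b t * (a * p) + smoothC tau a b t * v
    + conv (smoothC tau a b) g t).
  - apply (filter_imp (fun x => x < tau)); [|apply open_lt; lra].
    intros x Hx. unfold forward_derivative.
    rewrite delayS_neg, pos_part_neg, conv_0 by lra. Rring.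
  - evar_last.
    + apply @is_derive_plus; [apply @is_derive_plus|].
      * now apply Rderive_scal_r, smoothS_derive.
      * now apply Rderive_scal_r, smoothC_derive.
      * apply conv_smoothC_derive; trivial; lra.
    + unfold forward_solution, plus. simpl.
      rewrite delayS_neg, pos_part_neg, !conv_0 by lra. Rring.
Qed.

(** After [tau] the delayed parts have become active: together they contribute
    [b] times the solution at [t - tau], and [g] loses the constant [b * p]. *)
Lemma forward_derivative_derive_later (a b tau p v : R) (g : R -> R) (t : R) :
  0 < tau -> (forall x, continuous g x) -> tau < t ->
  is_derive (forward_derivative a b tau p v g) t
    (a * forward_solution a b tau p v g t
     + b * forward_solution a b tau p v g (t - tau) + (g t - b * p)).
Proof.
  intros Htau Hg Ht.
  apply is_derive_ext_loc with (fun t =>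
    smoothS tau a b t * (a * p) + smoothS tau a b (t - tau) * (b * p)
    + smoothC tau a b t * v
    + (conv (smoothC tau a b) g t
       - conv (smoothC tau a b) (fun _ => b * p) (t - tau))).
  - apply (filter_imp (fun x => tau < x)); [|now apply open_gt].
    intros x Hx. unfold forward_derivative.
    rewrite delayS_pos, pos_part_pos by lra. Rring.
  - evar_last.
    + apply @is_derive_plus;
        [apply @is_derive_plus; [apply @is_derive_plus|]
        |apply @is_derive_minus].
      * now apply Rderive_scal_r, smoothS_derive.
      * apply (Rderive_shift (fun x => smoothS tau a b x * (b * p))).
        now apply Rderive_scal_r, smoothS_derive.
      * now apply Rderive_scal_r, smoothC_derive.
      * apply conv_smoothC_derive; trivial; lra.
      * apply Rderive_shift.
        apply conv_smoothC_derive; trivial; [|lra].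
        intros. apply continuous_const.
    + unfold forward_solution, plus, minus, plus, opp. simpl.
      rewrite (pos_part_pos (t - tau)), delayS_pos by lra. Rring.
Qed.

Lemma solution_exists (a b tau : R) (N : nat) (f phi dphi : R -> R) :
  0 < tau -> C1_on (Icc (- tau) 0) phi dphi ->
  continuous_on (Icc 0 (INR N * tau)) f ->
  exists y, stepwise_solution a b tau N f phi dphi y.
Proof.
  intros Htau [Hphi Hdphi] Hf.
  assert (HT : 0 <= INR N * tau) by (apply Rmult_le_pos; [apply pos_INR|lra]).
  set (cl := clamp (- tau) 0).
  set (Phi := fun s => phi (cl s)). set (DPhi := fun s => dphi (cl s)).
  set (F := fun s => f (clamp 0 (INR N * tau) s)).
  set (g := fun s => b * Phi (s - tau) + F s).
  set (Y := forward_solution a b tau (phi 0) (dphi 0) g).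
  set (DY := forward_derivative a b tau (phi 0) (dphi 0) g).
  assert (Hcl : forall s, - tau <= s <= 0 -> cl s = s).
  { intros s Hs. now apply clamp_id. }
  assert (HphiD : forall s, Icc (- tau) 0 s ->
                  is_derive_on (Icc (- tau) 0) Phi s (DPhi s)).
  { intros s Hs. unfold DPhi. rewrite Hcl by exact Hs.
    apply is_derive_on_spec; trivial. intros eps.
    generalize (proj1 (is_derive_on_spec _ _ _ _ Hs) (Hphi s Hs) eps).
    apply filter_imp. intros x Hx HIx. unfold Phi.
    rewrite !Hcl by assumption. now apply Hx. }
  assert (HPhi : forall x, continuous Phi x).
  { intros x. apply continuous_clamp; [lra|].
    now apply (is_derive_on_continuous_on _ _ dphi). }
  assert (HDPhi : forall x, continuous DPhi x)
    by (intros x; apply continuous_clamp; trivial; lra).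
  assert (HF : forall x, continuous F x)
    by (intros x; apply continuous_clamp; trivial; lra).
  assert (Hg : forall x, continuous g x)
    by (intros x; unfold g; prove_continuous).
  assert (HYD : forall x, is_derive Y x (DY x))
    by (intros x; now apply forward_solution_derive).
  assert (HPhi0 : Phi 0 = phi 0) by (unfold Phi; rewrite Hcl; trivial; lra).
  assert (HDPhi0 : DPhi 0 = dphi 0) by (unfold DPhi; rewrite Hcl; trivial; lra).
  assert (HY0 : Phi 0 = Y 0)
    by (rewrite HPhi0; symmetry; now apply forward_solution_0).
  assert (HDY0 : DPhi 0 = DY 0)
    by (rewrite HDPhi0; symmetry; now apply forward_derivative_0).
  set (y := paste Phi Y). set (dy := paste DPhi DY).
  assert (Hy : forall x, continuous y x).
  { intros x. apply paste_continuous; trivial. intros s.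
    apply @ex_derive_continuous. eexists. apply HYD. }
  assert (Hdy : forall x, continuous dy x).
  { intros x. apply paste_continuous; trivial. intros s.
    now apply forward_derivative_continuous. }
  set (ddy := fun s => a * y s + b * y (s - tau) + F s).
  assert (Hddy : forall x, continuous ddy x)
    by (intros x; unfold ddy; prove_continuous).
  exists y, dy, ddy. split; [|split].
  - split; [|split].
    + apply continuous_on_forall. intros x _. apply Hy.
    + intros t Ht. apply paste_derive_on; trivial. lra.
    + apply continuous_on_forall. intros x _. apply Hdy.
  - intros k Hk lo hi.
    assert (Hlo : 0 <= lo).
    { apply Rmult_le_pos; [|lra].
      assert (1 <= INR k) by (apply (le_INR 1); lia). lra. }
    assert (Hhi : hi <= INR N * tau).
    { apply Rmult_le_compat_r; [lra|]. apply le_INR. lia. }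
    split; [|split; [|split]].
    + intros t Ht. unfold Ioo in Ht.
      apply is_derive_ext_loc with DY.
      { apply (filter_imp (fun x => 0 < x)); [|apply open_gt; lra].
        intros x Hx. symmetry. apply paste_pos. lra. }
      unfold ddy, y. rewrite (paste_pos _ _ t) by lra.
      destruct (Rtotal_order t tau) as [Hlt|[Heq|Hgt]].
      * rewrite paste_neg by lra.
        evar_last; [apply forward_derivative_derive_first; trivial; lra|].
        fold Y. unfold g. ring.
      * (* [tau] is the endpoint of a step, hence inside no step. *)
        exfalso. subst t. unfold lo, hi in Ht.
        assert (INR k < 2) by nra. assert (1 < INR k) by nra.
        apply (INR_lt 1) in H0. apply (INR_lt k 2) in H. lia.
      * rewrite paste_pos by lra.
        evar_last; [apply forward_derivative_derive_later; trivial|].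
        fold Y. unfold g, Phi.
        replace (cl (t - tau)) with 0; [ring|].
        unfold cl, clamp. rewrite Rmin_left, Rmax_right by lra. reflexivity.
    + apply continuous_on_forall. intros x _. apply Hddy.
    + exists ddy. split; [|trivial].
      apply continuous_on_forall. intros x _. apply Hddy.
    + intros t Ht. unfold Ioo in Ht. unfold ddy, F. rewrite clamp_id by lra.
      reflexivity.
  - intros t Ht. unfold y, dy.
    destruct (Rlt_dec t 0) as [Hneg|Hpos].
    + rewrite !paste_neg by trivial. unfold Phi, DPhi. now rewrite Hcl.
    + replace t with 0 by (destruct Ht; lra).
      rewrite !paste_pos, <- HY0, <- HDY0 by lra. now split.
Qed.

Theorem theorem4 :
  forall (a b tau T : R) (N : nat) (phi dphi f : R -> R),
    0 < tau -> (1 <= N)%nat -> T = INR N * tau ->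
    C1_on (Icc (- tau) 0) phi dphi ->
    continuous_on (Icc 0 T) f ->
    (exists y : R -> R, stepwise_solution a b tau N f phi dphi y) /\
    (forall y : R -> R, stepwise_solution a b tau N f phi dphi y ->
       (forall t, - tau <= t <= 0 -> y t = phi t) /\
       (forall t, 0 <= t <= T ->
          y t = delayC tau a b t * phi 0 + delayS tau a b t * dphi 0
                + RInt (fun s => delayS tau a b (t - tau - s) * b * phi s)
                    (- tau) 0
                + RInt (fun s => delayS tau a b (t - s) * f s) 0 t)).
Proof.
  intros a b tau T N phi dphi f Htau _ -> Hphi Hf. split.
  - now apply solution_exists.
  - intros y Hy. split.
    + destruct Hy as (dy & ddy & _ & _ & Hini). intros t Ht. now apply Hini.
    + intros t Ht. now apply (solution_formula a b tau N f phi dphi y).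
Qed.
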